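(* Let $(H,\alpha)$ and $(B,\beta)$ be Hom-Hopf algebras with $B$ finite-dimensional. Then the category ${}^{B}_{H}\mathbb{L}$ of left-left $(H,B)$-Hom-Long dimodules is identified with (is isomorphic, as a category, to) the category of left $(B^{*op}\otimes H)$-Hom-modules.
   Context: All vector spaces, maps and tensor products are over a fixed field $k$; Sweedler notation $\Delta(c)=c_1\otimes c_2$ is used, and $\rho(m)=m_{(-1)}\otimes m_{(0)}$ for coactions. A Hom-algebra $(A,\mu_A,1_A,\alpha)$: a linear space $A$ with a linear multiplication, $1_A\in A$ and a linear bijection $\alpha:A\to A$ with $\alpha(aa')=\alpha(a)\alpha(a')$, $\alpha(1_A)=1_A$, $\alpha(a)(a'a'')=(aa')\alpha(a'')$, $a1_A=1_Aa=\alpha(a)$. A left $(A,\alpha)$-Hom-module $(M,\cdot,\mu)$: a linear space $M$, linear $\cdot:A\otimes M\to M$, and a linear bijection $\mu:M\to M$ with $\mu(a\cdot m)=\alpha(a)\cdot\mu(m)$, $\alpha(a)\cdot(a'\cdot m)=(aa')\cdot\mu(m)$, $1_A\cdot m=\mu(m)$. Morphisms are linear maps $f$ with $f(a\cdot m)=a\cdot f(m)$ commuting with the structure maps. A Hom-coalgebra $(C,\Delta,\epsilon,\beta)$: linear $\Delta:C\to C\otimes C$, $\epsilon:C\to k$, and a linear bijection $\beta$ with $\Delta(\beta(c))=\beta(c_1)\otimes\beta(c_2)$, $\epsilon\circ\beta=\epsilon$, $\beta(c_1)\otimes c_{21}\otimes c_{22}=c_{11}\otimes c_{12}\otimes\beta(c_2)$,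 $\epsilon(c_1)c_2=c_1\epsilon(c_2)=\beta(c)$. A left $(C,\beta)$-Hom-comodule $(M,\rho,\mu)$: linear $\rho:M\to C\otimes M$ and a linear bijection $\mu$ with $\rho(\mu(m))=\beta(m_{(-1)})\otimes\mu(m_{(0)})$, $\epsilon(m_{(-1)})m_{(0)}=\mu(m)$, $\beta(m_{(-1)})\otimes m_{(0)(-1)}\otimes m_{(0)(0)}=m_{(-1)1}\otimes m_{(-1)2}\otimes\mu(m_{(0)})$. Morphisms are colinear maps commuting with the structure maps. A Hom-bialgebra $(H,\alpha)$: a Hom-algebra and Hom-coalgebra with the same structure map $\alpha$ such that $\Delta(hh')=\Delta(h)\Delta(h')$, $\Delta(1)=1\otimes1$, $\epsilon(hh')=\epsilon(h)\epsilon(h')$, $\epsilon(1)=1$. It is a Hom-Hopf algebra if there is a linear map $S:H\to H$ (antipode) with $S(h_1)h_2=h_1S(h_2)=\epsilon(h)1_H$ and $S\circ\alpha=\alpha\circ S$. A left-left $(H,B)$-Hom-Long dimodule $(M,\cdot,\rho,\mu)$: $(M,\cdot,\mu)$ is a left $(H,\alpha)$-Hom-module and $(M,\rho,\mu)$ is a left $(B,\beta)$-Hom-comodule with $\rho(h\cdot m)=\beta(m_{(-1)})\otimes\alpha(h)\cdot m_{(0)}$. The category ${}^{B}_{H}\mathbb{L}$ has these as objects and, as morphisms, the $H$-linear $B$-colinear maps commuting with structure maps. For $B$ finite-dimensional, $B^*$ is a Hom-Hopf algebra with $(f*g)(y)=f(\beta^{-2}(y_1))\,g(\beta^{-2}(y_2))$,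 $\Delta_{B^*}(f)(x\otimes y)=f(\beta^{-2}(xy))$, $1_{B^*}=\epsilon$, $\epsilon_{B^*}(f)=f(1_B)$, $S_{B^*}=S^*$, and structure map $f\mapsto f\circ\beta^{-1}$. $B^{*op}$ is $B^*$ with opposite multiplication (the product of $p$ and $q$ is $q*p$), and $B^{*op}\otimes H$ is the usual tensor product Hom-Hopf algebra with componentwise structure. *)

(* Defs.v *)
From HB Require Import structures.
From mathcomp Require Import all_boot ssralg ring_quotient sesquilinear vector.
From mathcomp Require Import boolp.
From mathcomp Require Import finmap monalg.

Set Implicit Arguments.
Unset Strict Implicit.
Unset Printing Implicit Defensive.

Import GRing.Theory.
Local Open Scope ring_scope.
Local Open Scope quotient_scope.

Reserved Notation "U ⊗ V" (at level 40, left associativity).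
Reserved Notation "u ⊗t v" (at level 40, left associativity).

Lemma linear_ext (k : nzRingType) (U V : lmodType k) (f g : {linear U -> V}) :
  f =1 g -> f = g.
Proof.
case: f g => [f [[cf] [af]]] [g [[cg] [ag]]] /= /funext fg.
move: cf af cg ag; rewrite fg => cf af cg ag.
by rewrite (Prop_irrelevance cf cg) (Prop_irrelevance af ag).
Qed.

Section Tensor.
Context {k : fieldType}.

Section FreeModule.
Context (K : choiceType) (W : lmodType k) (h : K -> W).

Definition free_lift (g : {malg k[K]}) : W := \sum_(x <- msupp g) g@_x *: h x.

Lemma free_liftEw (d : {fset K}) (g : {malg k[K]}) :
  (msupp g `<=` d)%fset -> free_lift g = \sum_(x <- d) g@_x *: h x.
Proof.
move=> le; rewrite /free_lift (big_fset_incl _ le) // => x _ /mcoeff_outdom ->.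
by rewrite scale0r.
Qed.

Fact free_lift_is_linear : linear free_lift.
Proof.
move=> a x y; pose d := (msupp x `|` msupp y)%fset.
have le : (msupp (a *: x + y) `<=` d)%fset.
  by apply: (fsubset_trans (msuppD_le _ _)); apply: fsetSU; apply: msuppZ_le.
rewrite (free_liftEw le) (free_liftEw (fsubsetUl _ _ : (msupp x `<=` d)%fset)).
rewrite (free_liftEw (fsubsetUr _ _ : (msupp y `<=` d)%fset)).
rewrite scaler_sumr -big_split /=; apply: eq_bigr => z _.
by rewrite mcoeffD mcoeffZ scalerDl scalerA.
Qed.

HB.instance Definition _ :=
  GRing.isLinear.Build k {malg k[K]} W *:%R free_lift free_lift_is_linear.

Lemma free_liftU (x : K) : free_lift << x >> = h x.
Proof.
by rewrite (free_liftEw msuppU_le) big_seq_fset1 mcoeffUU scale1r.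
Qed.

End FreeModule.

Section TensorDef.
Context (U V : lmodType k).

Let I : choiceType := (U * V)%type.
Local Notation F := {malg k[I]}.

Local Notation gen u v := (<< ((u, v) : I) >> : F).

(* The submodule of the free module on U * V spanned by the bilinearity
   relations *)
Inductive quot_tens_rel : F -> Prop :=
| TensRel0 : quot_tens_rel 0
| TensRelP a x y : quot_tens_rel x -> quot_tens_rel y -> quot_tens_rel (a *: x + y)
| TensRelL a u u' v :
    quot_tens_rel (gen (a *: u + u') v - (a *: gen u v + gen u' v))
| TensRelR a u v v' :
    quot_tens_rel (gen u (a *: v + v') - (a *: gen u v + gen u v')).

Definition quot_tens_relb : {pred F} := fun x => `[< quot_tens_rel x >].

Fact quot_tens_relb_zmod : zmod_closed quot_tens_relb.
Proof.
split=> [|x y /asboolP rx /asboolP ry]; apply/asboolP; first exact: TensRel0.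
by rewrite addrC -scaleN1r; apply: TensRelP.
Qed.

HB.instance Definition _ :=
  GRing.isZmodClosed.Build F quot_tens_relb quot_tens_relb_zmod.

Definition quot_tens := Quotient.quot quot_tens_relb.
HB.instance Definition _ := GRing.Zmodule.on quot_tens.

Let pi (x : F) : quot_tens := \pi_quot_tens x.

Let piE x y : quot_tens_rel (x - y) <-> pi x = pi y.
Proof.
split=> [r|]; first by apply/eqP; rewrite /pi -Quotient.idealrBE; apply/asboolP.
by move/eqP; rewrite /pi -Quotient.idealrBE => /asboolP.
Qed.

Let piK (q : quot_tens) : pi (repr q) = q.
Proof. exact: reprK. Qed.

Let piD x y : pi (x + y) = pi x + pi y.
Proof. exact: (raddfD \pi_(Quotient.quot quot_tens_relb)). Qed.

Let relZ a x : quot_tens_rel x -> quot_tens_rel (a *: x).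
Proof. by move=> r; rewrite -[_ *: _]addr0; apply: TensRelP r TensRel0. Qed.

Definition quot_tens_scale (a : k) (q : quot_tens) : quot_tens := pi (a *: repr q).

Let piZ a x : pi (a *: x) = quot_tens_scale a (pi x).
Proof. by apply/piE; rewrite -scalerBr; apply/relZ/piE; rewrite piK. Qed.

Fact quot_tens_scaleA a b q :
  quot_tens_scale a (quot_tens_scale b q) = quot_tens_scale (a * b) q.
Proof. by rewrite -[q]piK -!piZ scalerA. Qed.
Fact quot_tens_scale1 : left_id 1 quot_tens_scale.
Proof. by move=> q; rewrite -[q]piK -!piZ scale1r. Qed.
Fact quot_tens_scaleDr : right_distributive quot_tens_scale +%R.
Proof.
move=> a p q; rewrite -[p]piK -[q]piK.
by rewrite -[X in quot_tens_scale a X]piD -3!piZ scalerDr piD.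
Qed.
Fact quot_tens_scaleDl q : {morph quot_tens_scale^~ q : a b / a + b}.
Proof. by move=> a b; rewrite -[q]piK -3!piZ scalerDl piD. Qed.

HB.instance Definition _ := GRing.Zmodule_isLmodule.Build k quot_tens
  quot_tens_scaleA quot_tens_scale1 quot_tens_scaleDr quot_tens_scaleDl.

Definition quot_tens_pure (u : U) (v : V) : quot_tens := pi (gen u v).

Let pi_is_linear : linear pi.
Proof. by move=> a x y; rewrite piD piZ. Qed.

Fact quot_tens_pure_is_bilinear : bilinear_for *:%R *:%R quot_tens_pure.
Proof.
by split=> [v a u u'|u a v v'] /=; rewrite /quot_tens_pure -pi_is_linear; apply/piE;
  [apply: TensRelL | apply: TensRelR].
Qed.

Section Lift.
Context (W : lmodType k) (f : U -> V -> W).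
Context (bf : bilinear_for *:%R *:%R f).

Let h (p : U * V) : W := f p.1 p.2.

Definition quot_tens_lift_fun (q : quot_tens) : W := free_lift h (repr q).

Let liftP a x y : free_lift h (a *: x + y) = a *: free_lift h x + free_lift h y.
Proof. exact: free_lift_is_linear. Qed.

Let liftB x y : free_lift h (x - y) = free_lift h x - free_lift h y.
Proof. exact: linearB. Qed.

Let lift_pi x : quot_tens_lift_fun (pi x) = free_lift h x.
Proof.
apply/eqP; rewrite -subr_eq0 -liftB; apply/eqP.
have : quot_tens_rel (repr (pi x) - x) by apply/piE; rewrite piK.
elim=> [|a y z _ IHy _ IHz|a u u' v|a u v v']; first exact: linear0.
- by rewrite liftP IHy IHz scaler0 addr0.
- rewrite liftB liftP !free_liftU; apply/eqP; rewrite subr_eq0; apply/eqP.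
  exact: bf.1.
- rewrite liftB liftP !free_liftU; apply/eqP; rewrite subr_eq0; apply/eqP.
  exact: bf.2.
Qed.

Fact quot_tens_lift_is_linear : linear quot_tens_lift_fun.
Proof.
by move=> a p q; rewrite -[p]piK -[q]piK -pi_is_linear !lift_pi liftP.
Qed.

HB.instance Definition _ :=
  GRing.isLinear.Build k quot_tens W *:%R quot_tens_lift_fun
    quot_tens_lift_is_linear.

Definition quot_tens_lift : {linear quot_tens -> W} := quot_tens_lift_fun.

Lemma quot_tens_liftE u v : quot_tens_lift (quot_tens_pure u v) = f u v.
Proof. by rewrite /quot_tens_lift /= lift_pi free_liftU. Qed.

End Lift.

Lemma quot_tens_ind (P : quot_tens -> Prop) :
    (forall u v, P (quot_tens_pure u v)) ->
    (forall a p q, P p -> P q -> P (a *: p + q)) ->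
  forall q, P q.
Proof.
move=> Ppure Plin q; rewrite -[q]piK; move: (repr q) => {q} x.
have piZ' a y : pi (a *: y) = a *: pi y by exact: piZ.
have pi0 : pi 0 = 0 by exact: (raddf0 \pi_(Quotient.quot quot_tens_relb)).
have P0 : P 0.
  have := Plin (-1) _ _ (Ppure 0 0) (Ppure 0 0).
  by rewrite scaleN1r addNr.
rewrite (monalgE x); move: (enum_fset (msupp x)) => r.
elim: r => [|[u v] r IH].
  by rewrite big_nil pi0.
rewrite big_cons piD; have -> : << x@_(u, v) *g (u, v) >> = x@_(u, v) *: gen u v.
  by apply/malgP => z; rewrite mcoeffZ !mcoeffU mulrnAr mulr1.
by rewrite piZ'; exact: (Plin _ _ _ (Ppure u v) IH).
Qed.

End TensorDef.

(* A tensor product of U and V: a space with a bilinear map from U and V which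
   linearly spans it and through which all bilinear maps factor. *)
Record tensor_product (U V : lmodType k) := TensorProduct {
  tp_space : lmodType k;
  tp_pure : U -> V -> tp_space;
  tp_bilinear : bilinear_for *:%R *:%R tp_pure;
  tp_ind : forall P : tp_space -> Prop,
    (forall u v, P (tp_pure u v)) ->
    (forall a p q, P p -> P q -> P (a *: p + q)) -> forall q, P q;
  tp_lift : forall (W : lmodType k) (f : U -> V -> W),
    bilinear_for *:%R *:%R f -> {linear tp_space -> W};
  tp_liftE : forall (W : lmodType k) (f : U -> V -> W)
    (bf : bilinear_for *:%R *:%R f) u v, tp_lift bf (tp_pure u v) = f u v
}.

(* Locked, since unification otherwise unfolds the quotient. *)
Fact tens_key : unit. Proof. exact: tt. Qed.

Definition the_tensor (U V : lmodType k) : tensor_product U V :=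
  locked_with tens_key
    (TensorProduct (@quot_tens_pure_is_bilinear U V) (@quot_tens_ind U V)
       (@quot_tens_liftE U V)).

Definition tens (U V : lmodType k) : lmodType k := tp_space (the_tensor U V).

Section TensorTheory.
Context (U V : lmodType k).

Definition tens_pure (u : U) (v : V) : tens U V := tp_pure (the_tensor U V) u v.

Fact tens_pure_is_bilinear : bilinear_for *:%R *:%R tens_pure.
Proof. exact: tp_bilinear. Qed.

HB.instance Definition _ (u : U) :=
  GRing.isLinear.Build k V (tens U V) *:%R (tens_pure u)
    (tens_pure_is_bilinear.2 u).

Lemma tens_ind (P : tens U V -> Prop) :
    (forall u v, P (tens_pure u v)) ->
    (forall a p q, P p -> P q -> P (a *: p + q)) ->
  forall q, P q.
Proof. exact: tp_ind. Qed.

Definition tens_lift (W : lmodType k) (f : U -> V -> W)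
    (bf : bilinear_for *:%R *:%R f) : {linear tens U V -> W} :=
  tp_lift (the_tensor U V) bf.

Lemma tens_liftE (W : lmodType k) (f : U -> V -> W)
    (bf : bilinear_for *:%R *:%R f) u v :
  tens_lift bf (tens_pure u v) = f u v.
Proof. exact: tp_liftE. Qed.

Lemma tens_eq (W : lmodType k) (f g : {linear tens U V -> W}) :
  (forall u v, f (tens_pure u v) = g (tens_pure u v)) -> f =1 g.
Proof.
by move=> fg; apply: tens_ind => // a p q fgp fgq; rewrite !linearP fgp fgq.
Qed.

End TensorTheory.
End Tensor.

Notation "U ⊗ V" := (tens U V) : type_scope.
Notation "u ⊗t v" := (tens_pure u v) : ring_scope.

Section TensorMaps.
Context {k : fieldType}.
Implicit Types U V W : lmodType k.

Lemma tensPl U V (v : V) a (u u' : U) :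
  (a *: u + u') ⊗t v = a *: (u ⊗t v) + u' ⊗t v.
Proof. exact: (@tens_pure_is_bilinear k U V).1. Qed.

Lemma tensPr U V (u : U) a (v v' : V) :
  u ⊗t (a *: v + v') = a *: (u ⊗t v) + u ⊗t v'.
Proof. exact: (@tens_pure_is_bilinear k U V).2. Qed.

Definition lid U : {linear U -> U} := idfun.

Section Map.
Context (U U' V V' : lmodType k) (f : {linear U -> U'}) (g : {linear V -> V'}).
Fact tens_map_bilinear :
  bilinear_for *:%R *:%R (fun (u : U) (v : V) => f u ⊗t g v : U' ⊗ V').
Proof. by split=> [v a u u'|u a v v'] /=; rewrite linearP ?tensPl ?tensPr. Qed.
Definition tens_map : {linear U ⊗ V -> U' ⊗ V'} := tens_lift tens_map_bilinear.
Lemma tens_mapE u v : tens_map (u ⊗t v) = f u ⊗t g v.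
Proof. exact: tens_liftE. Qed.
End Map.

Section Swap.
Context (U V : lmodType k).
Fact tens_swap_bilinear :
  bilinear_for *:%R *:%R (fun (u : U) (v : V) => v ⊗t u : V ⊗ U).
Proof. by split=> [v a u u'|u a v v'] /=; rewrite ?tensPl ?tensPr. Qed.
Definition tens_swap : {linear U ⊗ V -> V ⊗ U} := tens_lift tens_swap_bilinear.
Lemma tens_swapE u v : tens_swap (u ⊗t v) = v ⊗t u.
Proof. exact: tens_liftE. Qed.
End Swap.

Section Scale.
Context (V : lmodType k).
Fact tens_scalel_bilinear :
  bilinear_for *:%R *:%R (fun (a : k^o) (v : V) => a *: v).
Proof.
split=> [v a b b'|b a v v'] /=; first by rewrite scalerDl scalerA.
by rewrite scalerDr !scalerA mulrC.
Qed.
Definition tens_scalel : {linear k^o ⊗ V -> V} := tens_lift tens_scalel_bilinear.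
Definition tens_scaler : {linear V ⊗ k^o -> V} := tens_scalel \o tens_swap V k^o.
Lemma tens_scalelE a v : tens_scalel (a ⊗t v) = a *: v.
Proof. exact: tens_liftE. Qed.
Lemma tens_scalerE a v : tens_scaler (v ⊗t a) = a *: v.
Proof. by rewrite /= tens_swapE tens_scalelE. Qed.
End Scale.

Let lin_swap W a b (x x' y y' : W) :
  b *: (a *: x + x') + (a *: y + y') = a *: (b *: x + y) + (b *: x' + y').
Proof. by rewrite !scalerDr !scalerA [b * a]mulrC addrACA. Qed.

Section Assoc.
Context (U V W : lmodType k).

Fact tens_assoc_aux1 (w : W) :
  bilinear_for *:%R *:%R (fun (u : U) (v : V) => u ⊗t (v ⊗t w)).
Proof. by split=> [v a u u'|u a v v'] /=; rewrite ?tensPl ?tensPr. Qed.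

Fact tens_assoc_aux2 :
  bilinear_for *:%R *:%R (fun t w => tens_lift (tens_assoc_aux1 w) t).
Proof.
split=> [w a t t'|t a w w']; first exact: (linearP (tens_lift (tens_assoc_aux1 w))).
rewrite /=; move: t; apply: tens_ind => [u v|b p q IHp IHq].
  by rewrite !tens_liftE !tensPr.
rewrite [LHS]linearP IHp IHq !(linearP (tens_lift _)); exact: lin_swap.
Qed.

Definition tens_assoc : {linear (U ⊗ V) ⊗ W -> U ⊗ (V ⊗ W)} :=
  tens_lift tens_assoc_aux2.

Lemma tens_assocE u v w : tens_assoc ((u ⊗t v) ⊗t w) = u ⊗t (v ⊗t w).
Proof. by rewrite !tens_liftE. Qed.

Fact tens_assocV_aux1 (u : U) :
  bilinear_for *:%R *:%R (fun (v : V) (w : W) => (u ⊗t v) ⊗t w).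
Proof.
by split=> [w a v v'|v a w w'] /=; rewrite ?(tensPr, tensPl).
Qed.

Fact tens_assocV_aux2 :
  bilinear_for *:%R *:%R (fun u t => tens_lift (tens_assocV_aux1 u) t).
Proof.
split=> [t a u u'|u a t t']; last exact: (linearP (tens_lift (tens_assocV_aux1 u))).
move: t; apply: tens_ind => [v w|b p q IHp IHq].
  by rewrite !tens_liftE !tensPl.
rewrite [LHS]linearP IHp IHq !(linearP (tens_lift _)); exact: lin_swap.
Qed.

Definition tens_assocV : {linear U ⊗ (V ⊗ W) -> (U ⊗ V) ⊗ W} :=
  tens_lift tens_assocV_aux2.

Lemma tens_assocVE u v w : tens_assocV (u ⊗t (v ⊗t w)) = (u ⊗t v) ⊗t w.
Proof. by rewrite !tens_liftE. Qed.
End Assoc.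

Section Interchange.
Context (A B C D : lmodType k).
Definition tens_ACA : {linear (A ⊗ B) ⊗ (C ⊗ D) -> (A ⊗ C) ⊗ (B ⊗ D)} :=
  tens_assocV A C (B ⊗ D)
  \o tens_map (lid A)
       (tens_assoc C B D \o
        tens_map (tens_swap B C) (lid D) \o tens_assocV B C D)
  \o tens_assoc A B (C ⊗ D).
Lemma tens_ACAE a b c d :
  tens_ACA ((a ⊗t b) ⊗t (c ⊗t d)) = (a ⊗t c) ⊗t (b ⊗t d).
Proof.
rewrite /tens_ACA /= tens_assocE tens_mapE /= tens_assocVE tens_mapE.
by rewrite tens_swapE tens_assocE tens_assocVE.
Qed.
End Interchange.

Definition tens_mul (A B : lmodType k) (mA : {linear A ⊗ A -> A})
    (mB : {linear B ⊗ B -> B}) : {linear (A ⊗ B) ⊗ (A ⊗ B) -> A ⊗ B} :=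
  tens_map mA mB \o tens_ACA A B A B.

Lemma tens_mulE (A B : lmodType k) (mA : {linear A ⊗ A -> A})
    (mB : {linear B ⊗ B -> B}) a b a' b' :
  tens_mul mA mB ((a ⊗t b) ⊗t (a' ⊗t b')) = mA (a ⊗t a') ⊗t mB (b ⊗t b').
Proof.
transitivity (tens_map mA mB (tens_ACA A B A B ((a ⊗t b) ⊗t (a' ⊗t b')))) => //.
by rewrite tens_ACAE tens_mapE.
Qed.

End TensorMaps.

Section HomStructures.
Context {k : fieldType}.

Record is_hom_algebra (A : lmodType k) (mul : {linear A ⊗ A -> A}) (one : A)
    (alpha : {linear A -> A}) : Prop := IsHomAlgebra {
  ha_bij : bijective alpha;
  ha_strM : forall a b, alpha (mul (a ⊗t b)) = mul (alpha a ⊗t alpha b);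
  ha_str1 : alpha one = one;
  ha_assoc : forall a b c,
    mul (alpha a ⊗t mul (b ⊗t c)) = mul (mul (a ⊗t b) ⊗t alpha c);
  ha_mul1 : forall a, mul (a ⊗t one) = alpha a;
  ha_1mul : forall a, mul (one ⊗t a) = alpha a
}.

Record hom_algebra (A : lmodType k) := HomAlgebra {
  ha_mul : {linear A ⊗ A -> A};
  ha_one : A;
  ha_str : {linear A -> A};
  ha_ax : is_hom_algebra ha_mul ha_one ha_str
}.

Record is_hom_module (A : lmodType k) (HA : hom_algebra A) (M : lmodType k)
    (act : {linear A ⊗ M -> M}) (mu : {linear M -> M}) : Prop := IsHomModule {
  hm_bij : bijective mu;
  hm_str : forall a m, mu (act (a ⊗t m)) = act (ha_str HA a ⊗t mu m);
  hm_assoc : forall a b m,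
    act (ha_str HA a ⊗t act (b ⊗t m)) = act (ha_mul HA (a ⊗t b) ⊗t mu m);
  hm_unit : forall m, act (ha_one HA ⊗t m) = mu m
}.

Record is_hom_coalgebra (C : lmodType k) (comul : {linear C -> C ⊗ C})
    (counit : {linear C -> k^o}) (beta : {linear C -> C}) : Prop :=
  IsHomCoalgebra {
  hc_bij : bijective beta;
  hc_strD : forall c, comul (beta c) = tens_map beta beta (comul c);
  hc_strE : forall c, counit (beta c) = counit c;
  hc_coassoc : forall c,
    tens_map beta comul (comul c) =
    tens_assoc C C C (tens_map comul beta (comul c));
  hc_counitl : forall c, tens_scalel C (tens_map counit (lid C) (comul c)) = beta c;
  hc_counitr : forall c, tens_scaler C (tens_map (lid C) counit (comul c)) = beta c
}.

Record hom_coalgebra (C : lmodType k) := HomCoalgebra {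
  hc_comul : {linear C -> C ⊗ C};
  hc_counit : {linear C -> k^o};
  hc_str : {linear C -> C};
  hc_ax : is_hom_coalgebra hc_comul hc_counit hc_str
}.

Record is_hom_comodule (C : lmodType k) (HC : hom_coalgebra C) (M : lmodType k)
    (rho : {linear M -> C ⊗ M}) (mu : {linear M -> M}) : Prop :=
  IsHomComodule {
  hcm_bij : bijective mu;
  hcm_str : forall m, rho (mu m) = tens_map (hc_str HC) mu (rho m);
  hcm_counit : forall m,
    tens_scalel M (tens_map (hc_counit HC) (lid M) (rho m)) = mu m;
  hcm_coassoc : forall m,
    tens_map (hc_str HC) rho (rho m) =
    tens_assoc C C M (tens_map (hc_comul HC) mu (rho m))
}.

Record hom_bialgebra (H : lmodType k) := HomBialgebra {
  hb_mul : {linear H ⊗ H -> H};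
  hb_one : H;
  hb_comul : {linear H -> H ⊗ H};
  hb_counit : {linear H -> k^o};
  hb_str : {linear H -> H};
  hb_is_alg : is_hom_algebra hb_mul hb_one hb_str;
  hb_is_coalg : is_hom_coalgebra hb_comul hb_counit hb_str;
  hb_comulM : forall h g,
    hb_comul (hb_mul (h ⊗t g)) =
    tens_mul hb_mul hb_mul (hb_comul h ⊗t hb_comul g);
  hb_comul1 : hb_comul hb_one = hb_one ⊗t hb_one;
  hb_counitM : forall h g,
    hb_counit (hb_mul (h ⊗t g)) = hb_counit h * hb_counit g;
  hb_counit1 : hb_counit hb_one = 1
}.

Definition hb_alg (H : lmodType k) (HB : hom_bialgebra H) : hom_algebra H :=
  HomAlgebra (hb_is_alg HB).

Definition hb_coalg (H : lmodType k) (HB : hom_bialgebra H) : hom_coalgebra H :=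
  HomCoalgebra (hb_is_coalg HB).

Record hom_hopf (H : lmodType k) := HomHopf {
  hh_bialg :> hom_bialgebra H;
  hh_antipode : {linear H -> H};
  hh_antipodel : forall h,
    hb_mul hh_bialg (tens_map hh_antipode (lid H) (hb_comul hh_bialg h)) =
    hb_counit hh_bialg h *: hb_one hh_bialg;
  hh_antipoder : forall h,
    hb_mul hh_bialg (tens_map (lid H) hh_antipode (hb_comul hh_bialg h)) =
    hb_counit hh_bialg h *: hb_one hh_bialg;
  hh_antipode_str : forall h,
    hh_antipode (hb_str hh_bialg h) = hb_str hh_bialg (hh_antipode h)
}.

Section Opposite.
Context (A : lmodType k) (HA : hom_algebra A).

Definition op_mul : {linear A ⊗ A -> A} := ha_mul HA \o tens_swap A A.

Lemma op_mulE a b : op_mul (a ⊗t b) = ha_mul HA (b ⊗t a).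
Proof. by rewrite /op_mul /= tens_swapE. Qed.

Fact op_is_hom_algebra : is_hom_algebra op_mul (ha_one HA) (ha_str HA).
Proof.
case: (ha_ax HA) => bij sM s1 sA m1 lm; split=> // [a b|a b c|a|a].
all: rewrite !op_mulE //.
Qed.

Definition op_alg : hom_algebra A := HomAlgebra op_is_hom_algebra.
End Opposite.

Section TensorAlgebra.
Context (A B : lmodType k) (HA : hom_algebra A) (HB : hom_algebra B).

Let mul := tens_mul (ha_mul HA) (ha_mul HB).
Let str := tens_map (ha_str HA) (ha_str HB).

Let pure_str a b : str (a ⊗t b) = ha_str HA a ⊗t ha_str HB b.
Proof. exact: tens_mapE. Qed.

Let pure_mul a b a' b' :
  mul ((a ⊗t b) ⊗t (a' ⊗t b')) = ha_mul HA (a ⊗t a') ⊗t ha_mul HB (b ⊗t b').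
Proof. exact: tens_mulE. Qed.

Let mulPl t a x y : mul ((a *: x + y) ⊗t t) = a *: mul (x ⊗t t) + mul (y ⊗t t).
Proof. by rewrite tensPl [LHS]linearP. Qed.

Let mulPr t a x y : mul (t ⊗t (a *: x + y)) = a *: mul (t ⊗t x) + mul (t ⊗t y).
Proof. by rewrite tensPr [LHS]linearP. Qed.

Let strP a x y : str (a *: x + y) = a *: str x + str y.
Proof. exact: linearP. Qed.

Fact tens_is_hom_algebra : is_hom_algebra mul (ha_one HA ⊗t ha_one HB) str.
Proof.
case: (ha_ax HA) (ha_ax HB) => bijA sMA s1A sAA m1A lmA.
case=> bijB sMB s1B sAB m1B lmB; split.
- have inv_lin (V : lmodType k) (f : {linear V -> V}) (g : V -> V) :
      cancel f g -> cancel g f -> linear g.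
    by move=> fK gK a x y; apply: (can_inj fK); rewrite gK linearP !gK.
  have [gA fKA gKA] := bijA; have [gB fKB gKB] := bijB.
  pose GA : {linear A -> A} := HB.pack gA (GRing.isLinear.Build k A A *:%R gA
    (inv_lin _ _ _ fKA gKA)).
  pose GB : {linear B -> B} := HB.pack gB (GRing.isLinear.Build k B B *:%R gB
    (inv_lin _ _ _ fKB gKB)).
  exists (tens_map GA GB); apply: tens_ind => [a b|a p q IHp IHq].
  + by rewrite pure_str tens_mapE [GA _]fKA [GB _]fKB.
  + by rewrite strP [LHS]linearP IHp IHq.
  + by rewrite tens_mapE pure_str [ha_str HA _]gKA [ha_str HB _]gKB.
  + by rewrite [X in str X]linearP strP IHp IHq.
- apply: tens_ind => [a b|a p q IHp IHq] t; last first.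
    by rewrite mulPl !strP mulPl IHp IHq.
  move: t; apply: tens_ind => [a' b'|c p q IHp IHq]; last first.
    by rewrite mulPr !strP mulPr IHp IHq.
  by rewrite pure_mul !pure_str pure_mul sMA sMB.
- by rewrite pure_str s1A s1B.
- apply: tens_ind => [a b|a p q IHp IHq] t t'; last first.
    by rewrite strP !mulPl IHp IHq.
  move: t t'; apply: tens_ind => [a' b'|c p q IHp IHq] t'; last first.
    by rewrite !(mulPr, mulPl) IHp IHq.
  move: t'; apply: tens_ind => [a'' b''|c p q IHp IHq]; last first.
    by rewrite strP !mulPr IHp IHq.
  by rewrite !pure_str !pure_mul sAA sAB.
- apply: tens_ind => [a b|a p q IHp IHq]; last by rewrite strP mulPl IHp IHq.
  by rewrite pure_mul pure_str m1A m1B.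
- apply: tens_ind => [a b|a p q IHp IHq]; last by rewrite strP mulPr IHp IHq.
  by rewrite pure_mul pure_str lmA lmB.
Qed.

Definition tens_alg : hom_algebra (A ⊗ B) := HomAlgebra tens_is_hom_algebra.
End TensorAlgebra.

(* Hom-modules only involve multiplication, unit and structure map, so B^*, its
   opposite and B^*op ⊗ H are built as Hom-algebras only. *)
Section DualAlgebra.
Context (B : vectType k) (HB : hom_coalgebra B).

Let beta : {linear B -> B} := hc_str HB.
Let Delta : {linear B -> B ⊗ B} := hc_comul HB.

(* beta is bijective, so this is its two-sided inverse: str_invK and strK *)
Definition str_inv : 'End(B) := (linfun beta)^-1%VF.

Lemma str_invK : cancel str_inv beta.
Proof.
have [g betaK gK] := hc_bij (hc_ax HB).
have ker0 : lker (linfun beta) == 0%VS.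
  by apply/lker0P => x y; rewrite !lfunE; apply: (can_inj betaK).
move=> y; have := lker0_lfunVK ker0 y; by rewrite [LHS]lfunE.
Qed.

Lemma strK : cancel beta str_inv.
Proof.
have [g betaK gK] := hc_bij (hc_ax HB).
by move=> y; apply: (can_inj betaK); rewrite -/beta str_invK.
Qed.

Definition tens_form (f g : 'Hom(B, k^o)) : {linear B ⊗ B -> k^o} :=
  tens_scalel k^o \o tens_map f g.

Lemma tens_formE f g x y : tens_form f g (x ⊗t y) = f x * g y.
Proof. by rewrite /tens_form /= tens_mapE tens_scalelE. Qed.

(* (f * g)(y) = f (beta^-2 y_1) * g (beta^-2 y_2) *)
Definition dual_conv (f g : 'Hom(B, k^o)) : 'Hom(B, k^o) :=
  linfun (tens_form (f \o str_inv \o str_inv)%VF (g \o str_inv \o str_inv)%VF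
          \o Delta).

Fact dual_conv_bilinear : bilinear_for *:%R *:%R dual_conv.
Proof.
have convE f g y : dual_conv f g y =
  tens_form (f \o str_inv \o str_inv)%VF (g \o str_inv \o str_inv)%VF (Delta y).
  by rewrite [LHS]lfunE.
split=> [g a f f'|f a g g']; apply/lfunP => y; rewrite add_lfunE scale_lfunE !convE;
  move: (Delta y); apply: tens_ind => [b c|d p q IHp IHq].
- rewrite !tens_formE !comp_lfunE add_lfunE scale_lfunE /=.
  by rewrite mulrDl -mulrA.
- rewrite [LHS]linearP IHp IHq !(linearP (tens_form _ _)) !scalerDr !scalerA.
  by rewrite [d * a]mulrC addrACA.
- rewrite !tens_formE !comp_lfunE add_lfunE scale_lfunE /=.
  by rewrite mulrDr mulrCA.
- rewrite [LHS]linearP IHp IHq !(linearP (tens_form _ _)) !scalerDr !scalerA.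
  by rewrite [d * a]mulrC addrACA.
Qed.

Definition dual_mul : {linear 'Hom(B, k^o) ⊗ 'Hom(B, k^o) -> 'Hom(B, k^o)} :=
  tens_lift dual_conv_bilinear.

Lemma dual_mulE f g y : dual_mul (f ⊗t g) y =
  tens_form (f \o str_inv \o str_inv)%VF (g \o str_inv \o str_inv)%VF (Delta y).
Proof. by rewrite /dual_mul tens_liftE [LHS]lfunE. Qed.

Definition dual_one : 'Hom(B, k^o) := linfun (hc_counit HB).

Definition dual_str_fun (f : 'Hom(B, k^o)) : 'Hom(B, k^o) := (f \o str_inv)%VF.

Fact dual_str_is_linear : linear dual_str_fun.
Proof.
by move=> a f g; apply/lfunP => y; rewrite !(comp_lfunE, add_lfunE, scale_lfunE).
Qed.

HB.instance Definition _ :=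
  GRing.isLinear.Build k 'Hom(B, k^o) 'Hom(B, k^o) *:%R dual_str_fun
    dual_str_is_linear.

Definition dual_str : {linear 'Hom(B, k^o) -> 'Hom(B, k^o)} := dual_str_fun.

Lemma dual_strE f y : dual_str f y = f (str_inv y).
Proof. exact: comp_lfunE. Qed.

Let DeltaV y : Delta (str_inv y) = tens_map str_inv str_inv (Delta y).
Proof.
rewrite -[in RHS](str_invK y) (hc_strD (hc_ax HB)) -/beta -/Delta.
move: (Delta (str_inv y)); apply: tens_ind => [b c|a p q IHp IHq].
  by rewrite !tens_mapE; congr (_ ⊗t _); apply/esym/strK.
by rewrite !(linearP (tens_map _ _)) -IHp -IHq.
Qed.

Let counitV y : hc_counit HB (str_inv y) = hc_counit HB y.
Proof. by rewrite -[in RHS](str_invK y) (hc_strE (hc_ax HB)). Qed.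

Let formV f g t : tens_form f g (tens_map str_inv str_inv t) =
  tens_form (f \o str_inv)%VF (g \o str_inv)%VF t.
Proof.
move: t; apply: tens_ind => [b c|a p q IHp IHq].
  by rewrite tens_mapE !tens_formE !comp_lfunE.
by rewrite (linearP (tens_map _ _)) !(linearP (tens_form _ _)) IHp IHq.
Qed.

Fact dual_is_hom_algebra : is_hom_algebra dual_mul dual_one dual_str.
Proof.
pose V2 := (str_inv \o str_inv)%VF; pose V4 := (V2 \o V2)%VF.
have conv2 f g y : dual_mul (f ⊗t g) (str_inv (str_inv y)) =
    tens_form (f \o V4)%VF (g \o V4)%VF (Delta y).
  rewrite dual_mulE !DeltaV !formV.
  by congr (tens_form _ _ _); apply/lfunP => z; rewrite /V4 /V2 !comp_lfunE.
split.
- exists (fun f : 'Hom(B, k^o) => (f \o linfun beta)%VF) => f; apply/lfunP => y.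
    by rewrite comp_lfunE dual_strE lfunE /= strK.
  by rewrite dual_strE comp_lfunE lfunE /= str_invK.
- move=> f g; apply/lfunP => y; rewrite dual_strE !dual_mulE DeltaV formV.
  by congr (tens_form _ _ _); apply/lfunP => z; rewrite /V4 /V2 !comp_lfunE.
- by apply/lfunP => y; rewrite dual_strE !lfunE /= counitV.
- move=> f g h; apply/lfunP => y; rewrite !dual_mulE.
  pose T : {linear B ⊗ (B ⊗ B) -> k^o} := tens_scalel k^o \o
    tens_map (f \o V4)%VF (tens_form (g \o V4)%VF (h \o V4)%VF).
  have TE b t : T (b ⊗t t) =
      f (V4 b) * tens_form (g \o V4)%VF (h \o V4)%VF t.
    transitivity (tens_scalel k^o (tens_map (f \o V4)%VF
      (tens_form (g \o V4)%VF (h \o V4)%VF) (b ⊗t t))); first by [].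
    by rewrite tens_mapE tens_scalelE -[f (V4 b)]comp_lfunE.
  transitivity (T (tens_map beta Delta (Delta y))).
    move: (Delta y); apply: tens_ind => [b c|a p q IHp IHq]; last first.
      rewrite (linearP (tens_map _ _)) (linearP T) -IHp -IHq.
      exact: (linearP (tens_form _ _)).
    rewrite tens_mapE TE tens_formE !comp_lfunE conv2; congr (_ * _).
    by rewrite !strK.
  rewrite (hc_coassoc (hc_ax HB)) -/beta -/Delta.
  move: (Delta y); apply: tens_ind => [b c|a p q IHp IHq]; last first.
    rewrite (linearP (tens_map _ _)) (linearP (tens_assoc _ _ _)) (linearP T).
    rewrite IHp IHq; exact/esym/(linearP (tens_form _ _)).
  rewrite tens_mapE tens_formE !comp_lfunE conv2.
  have -> : str_inv (str_inv (str_inv c)) = V4 (beta c).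
    by rewrite !comp_lfunE strK.
  move: (Delta b); apply: tens_ind => [b1 b2|a p q IHp IHq].
    by rewrite tens_assocE TE !tens_formE !comp_lfunE mulrA.
  rewrite tensPl (linearP (tens_assoc _ _ _)) (linearP T) IHp IHq.
  by rewrite (linearP (tens_form _ _)) mulrDl scalerAl.
- move=> f; apply/lfunP => y; rewrite dual_mulE dual_strE.
  rewrite -[in RHS](strK y) -(hc_counitr (hc_ax HB)) -/Delta.
  move: (Delta y); apply: tens_ind => [b c|a p q IHp IHq].
    rewrite tens_formE tens_mapE tens_scalerE !comp_lfunE lfunE /= !counitV.
    by rewrite !linearZ mulrC.
  rewrite (linearP (tens_form _ _)) IHp IHq.
  by rewrite (linearP (tens_map _ _)) (linearP (tens_scaler _)) !linearP.
- move=> f; apply/lfunP => y; rewrite dual_mulE dual_strE.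
  rewrite -[in RHS](strK y) -(hc_counitl (hc_ax HB)) -/Delta.
  move: (Delta y); apply: tens_ind => [b c|a p q IHp IHq].
    rewrite tens_formE tens_mapE tens_scalelE !comp_lfunE lfunE /= !counitV.
    by rewrite !linearZ.
  rewrite (linearP (tens_form _ _)) IHp IHq.
  by rewrite (linearP (tens_map _ _)) (linearP (tens_scalel _)) !linearP.
Qed.

Definition dual_alg : hom_algebra 'Hom(B, k^o) := HomAlgebra dual_is_hom_algebra.

End DualAlgebra.

End HomStructures.

Record category := Category {
  ob : Type;
  hom : ob -> ob -> Type;
  cid : forall X, hom X X;
  ccomp : forall X Y Z, hom Y Z -> hom X Y -> hom X Z;
  ccomp1f : forall X Y (f : hom X Y), ccomp (cid Y) f = f;
  ccompf1 : forall X Y (f : hom X Y), ccomp f (cid X) = f;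
  ccompA : forall X Y Z T (h : hom Z T) (g : hom Y Z) (f : hom X Y),
    ccomp h (ccomp g f) = ccomp (ccomp h g) f
}.
Arguments hom {c} _ _.
Arguments cid {c} _.
Arguments ccomp {c X Y Z} _ _.

Record functor (C D : category) := Functor {
  fob : ob C -> ob D;
  fhom : forall X Y, hom X Y -> hom (fob X) (fob Y);
  fhom1 : forall X, fhom (cid X) = cid (fob X);
  fhomM : forall X Y Z (g : hom Y Z) (f : hom X Y),
    fhom (ccomp g f) = ccomp (fhom g) (fhom f)
}.
Arguments fhom {C D} _ {X Y} _.

Definition functor_id (C : category) : functor C C :=
  @Functor C C id (fun X Y f => f) (fun X => erefl) (fun X Y Z g f => erefl).

Section FunctorComp.
Context (C D E : category) (G : functor D E) (F : functor C D).

Fact functor_comp1 X : fhom G (fhom F (cid X)) = cid (fob G (fob F X)).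
Proof. by rewrite !fhom1. Qed.

Fact functor_compM X Y Z (g : hom Y Z) (f : @hom C X Y) :
  fhom G (fhom F (ccomp g f)) = ccomp (fhom G (fhom F g)) (fhom G (fhom F f)).
Proof. by rewrite !fhomM. Qed.

Definition functor_comp : functor C E :=
  @Functor C E (fun X => fob G (fob F X)) (fun X Y f => fhom G (fhom F f))
    functor_comp1 functor_compM.
End FunctorComp.

(* Isomorphism, not mere equivalence: the composites are equal to the
   identity functors. *)
Definition cat_isomorphic (C D : category) : Prop :=
  exists (F : functor C D) (G : functor D C),
    functor_comp G F = functor_id C /\ functor_comp F G = functor_id D.

Section HomModules.
Context {k : fieldType} (A : lmodType k) (HA : hom_algebra A).

Record hom_module := HomModule {
  hm_space : lmodType k;
  hm_act : {linear A ⊗ hm_space -> hm_space};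
  hm_mu : {linear hm_space -> hm_space};
  hm_ax : is_hom_module HA hm_act hm_mu
}.

Record hom_module_hom (M N : hom_module) := HomModuleHom {
  hmh_fun : {linear hm_space M -> hm_space N};
  hmh_act : forall a m,
    hmh_fun (hm_act M (a ⊗t m)) = hm_act N (a ⊗t hmh_fun m);
  hmh_mu : forall m, hmh_fun (hm_mu M m) = hm_mu N (hmh_fun m)
}.

Lemma hom_module_hom_eq M N (f g : hom_module_hom M N) :
  hmh_fun f =1 hmh_fun g -> f = g.
Proof.
case: f g => [f fa fm] [g ga gm] /= /linear_ext fg.
move: fa fm ga gm; rewrite fg => fa fm ga gm.
by rewrite (Prop_irrelevance fa ga) (Prop_irrelevance fm gm).
Qed.

Definition hom_module_id (M : hom_module) : hom_module_hom M M :=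
  @HomModuleHom M M (lid (hm_space M)) (fun _ _ => erefl) (fun _ => erefl).

Section Comp.
Context (M N P : hom_module).
Context (g : hom_module_hom N P) (f : hom_module_hom M N).
Let gf : {linear hm_space M -> hm_space P} := hmh_fun g \o hmh_fun f.
Fact hom_module_comp_act a m : gf (hm_act M (a ⊗t m)) = hm_act P (a ⊗t gf m).
Proof. by rewrite /gf /= !hmh_act. Qed.
Fact hom_module_comp_mu m : gf (hm_mu M m) = hm_mu P (gf m).
Proof. by rewrite /gf /= !hmh_mu. Qed.
Definition hom_module_comp : hom_module_hom M P :=
  HomModuleHom hom_module_comp_act hom_module_comp_mu.
End Comp.

Definition hom_module_cat : category.
Proof.
by refine (@Category hom_module hom_module_hom hom_module_id
  hom_module_comp _ _ _) => *; apply: hom_module_hom_eq.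
Defined.

End HomModules.

Section LongDimodules.
Context {k : fieldType} (H B : lmodType k).
Context (HH : hom_hopf H) (HB : hom_hopf B).

Definition act_by (M : lmodType k) (act : {linear H ⊗ M -> M}) (h : H) :
  {linear M -> M} := act \o tens_pure h.

Record long_dimodule := LongDimodule {
  ld_space : lmodType k;
  ld_act : {linear H ⊗ ld_space -> ld_space};
  ld_coact : {linear ld_space -> B ⊗ ld_space};
  ld_mu : {linear ld_space -> ld_space};
  ld_is_module : is_hom_module (hb_alg HH) ld_act ld_mu;
  ld_is_comodule : is_hom_comodule (hb_coalg HB) ld_coact ld_mu;
  ld_compat : forall h m,
    ld_coact (ld_act (h ⊗t m)) =
    tens_map (hb_str HB) (act_by ld_act (hb_str HH h)) (ld_coact m)
}.

Record long_dimodule_hom (M N : long_dimodule) := LongDimoduleHom {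
  ldh_fun : {linear ld_space M -> ld_space N};
  ldh_act : forall h m,
    ldh_fun (ld_act M (h ⊗t m)) = ld_act N (h ⊗t ldh_fun m);
  ldh_coact : forall m,
    ld_coact N (ldh_fun m) = tens_map (lid B) ldh_fun (ld_coact M m);
  ldh_mu : forall m, ldh_fun (ld_mu M m) = ld_mu N (ldh_fun m)
}.

Lemma long_dimodule_hom_eq M N (f g : long_dimodule_hom M N) :
  ldh_fun f =1 ldh_fun g -> f = g.
Proof.
case: f g => [f fa fc fm] [g ga gc gm] /= /linear_ext fg.
move: fa fc fm ga gc gm; rewrite fg => fa fc fm ga gc gm.
by rewrite (Prop_irrelevance fa ga) (Prop_irrelevance fc gc)
  (Prop_irrelevance fm gm).
Qed.

Section Id.
Context (M : long_dimodule).
Fact long_dimodule_id_coact m :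
  ld_coact M m = tens_map (lid B) (lid (ld_space M)) (ld_coact M m).
Proof.
have := tens_eq (f := lid _) (g := tens_map (lid B) (lid (ld_space M))).
by apply=> b n; rewrite tens_mapE.
Qed.
Definition long_dimodule_id : long_dimodule_hom M M :=
  @LongDimoduleHom M M (lid (ld_space M)) (fun _ _ => erefl)
    long_dimodule_id_coact (fun _ => erefl).
End Id.

Section Comp.
Context (M N P : long_dimodule).
Context (g : long_dimodule_hom N P) (f : long_dimodule_hom M N).
Let gf : {linear ld_space M -> ld_space P} := ldh_fun g \o ldh_fun f.
Fact long_dimodule_comp_act h m : gf (ld_act M (h ⊗t m)) = ld_act P (h ⊗t gf m).
Proof. by rewrite /gf /= !ldh_act. Qed.
Fact long_dimodule_comp_coact m :
  ld_coact P (gf m) = tens_map (lid B) gf (ld_coact M m).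
Proof.
rewrite /gf /= !ldh_coact.
move: (ld_coact M m); apply: tens_ind => [b n|a p q IHp IHq].
  by rewrite !tens_mapE.
by rewrite !(linearP (tens_map _ _)) IHp IHq.
Qed.
Fact long_dimodule_comp_mu m : gf (ld_mu M m) = ld_mu P (gf m).
Proof. by rewrite /gf /= !ldh_mu. Qed.
Definition long_dimodule_comp : long_dimodule_hom M P :=
  LongDimoduleHom long_dimodule_comp_act long_dimodule_comp_coact
    long_dimodule_comp_mu.
End Comp.

Definition long_dimodule_cat : category.
Proof.
by refine (@Category long_dimodule long_dimodule_hom long_dimodule_id
  long_dimodule_comp _ _ _) => *; apply: long_dimodule_hom_eq.
Defined.

End LongDimodules.

(* Main.v *)
From Stdlib Require Import Eqdep.
From HB Require Import structures.
From mathcomp Require Import all_boot ssralg sesquilinear vector boolp.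
Require Import Defs.

(* Evaluating the first leg of [rho m] at [f] in B^* gives an action
   f . m = f(m_(-1)) m_(0).  As B is finite-dimensional these evaluations jointly
   determine [rho], and the comodule axioms of [rho] are exactly the module axioms
   of the action over B^*op, while the Long condition becomes the symmetric
   relation alpha(f) . (h . m) = alpha(h) . (f . m).  For arbitrary Hom-algebras A
   and A', a pair of module structures with the same structure map mu satisfying
   this relation is the same as a module structure over A ⊗ A', through
   mu((a ⊗ a') . m) = alpha(a) . (a' . m). *)

Set Implicit Arguments.
Unset Strict Implicit.
Unset Printing Implicit Defensive.

Import GRing.Theory.
Local Open Scope ring_scope.

(** * Inverses of bijective linear maps *)

Section LinearInverse.
Context (k : nzRingType) (V : lmodType k) (f : {linear V -> V}).
Hypothesis bf : bijective f.

Fact linear_inverse_exists :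
  exists g : {linear V -> V}, cancel f g /\ cancel g f.
Proof.
have [g fK gK] := bf.
have lg : linear g by move=> a x y; apply: (can_inj fK); rewrite gK linearP !gK.
pose G : {linear V -> V} := HB.pack g (GRing.isLinear.Build k V V *:%R g lg).
by exists G.
Qed.

(** [bijective] is a proposition, so its witness has to be extracted by choice. *)
Definition linear_inverse : {linear V -> V} :=
  sval (boolp.cid linear_inverse_exists).

Lemma linear_inverseK : cancel f linear_inverse.
Proof. exact: (svalP (boolp.cid linear_inverse_exists)).1. Qed.

Lemma linear_inverseVK : cancel linear_inverse f.
Proof. exact: (svalP (boolp.cid linear_inverse_exists)).2. Qed.
End LinearInverse.

(** * Modules over a tensor product of two Hom-algebras *)

Section TensorModules.
Context (k : fieldType) (A A' : lmodType k).
Context (HA : hom_algebra A) (HA' : hom_algebra A').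

Definition commuting_actions (M : lmodType k) (act : {linear A ⊗ M -> M})
    (act' : {linear A' ⊗ M -> M}) : Prop :=
  forall a a' m, act (ha_str HA a ⊗t act' (a' ⊗t m)) =
                 act' (ha_str HA' a' ⊗t act (a ⊗t m)).

Section PairAction.
Context (M : lmodType k) (mu : {linear M -> M}) (bmu : bijective mu).
Context (act : {linear A ⊗ M -> M}) (act' : {linear A' ⊗ M -> M}).

(** The inverse of [mu] is forced: in a module over the tensor product, acting by a' and then by
    alpha(a) gives [mu] of the action of a ⊗ a', as [restrict_lr] shows. *)
Definition pair_act : {linear (A ⊗ A') ⊗ M -> M} :=
  linear_inverse bmu \o (act \o (tens_map (ha_str HA) act' \o tens_assoc A A' M)).

Lemma pair_actE a a' m :
  mu (pair_act ((a ⊗t a') ⊗t m)) = act (ha_str HA a ⊗t act' (a' ⊗t m)).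
Proof. by rewrite /pair_act /= linear_inverseVK tens_assocE tens_mapE. Qed.

Hypothesis mact : is_hom_module HA act mu.
Hypothesis mact' : is_hom_module HA' act' mu.

(** The unit acts as [mu], which cancels the inverse inside [pair_act]. *)
Lemma pair_actl a m : pair_act ((a ⊗t ha_one HA') ⊗t m) = act (a ⊗t m).
Proof.
by apply: (bij_inj bmu); rewrite pair_actE (hm_unit mact') (hm_str mact).
Qed.

Lemma pair_actr a' m : pair_act ((ha_one HA ⊗t a') ⊗t m) = act' (a' ⊗t m).
Proof.
apply: (bij_inj bmu); rewrite pair_actE (ha_str1 (ha_ax HA)).
by rewrite (hm_unit mact).
Qed.

Lemma pair_act_module :
  commuting_actions act act' -> is_hom_module (tens_alg HA HA') pair_act mu.
Proof.
move=> comm.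
have str : forall t m, mu (pair_act (t ⊗t m)) =
    pair_act (ha_str (tens_alg HA HA') t ⊗t mu m).
  apply: tens_ind => [a a'|c p q IHp IHq] m; last first.
    by rewrite tensPl !linearP tensPl linearP IHp IHq.
  rewrite [ha_str _ _]tens_mapE; apply: (bij_inj bmu).
  by rewrite !pair_actE (hm_str mact) (hm_str mact').
split=> // [|m]; last first.
  by rewrite pair_actl (hm_unit mact).
apply: tens_ind => [a a'|c p q IHp IHq] t m; last first.
  by rewrite [in LHS]linearP !tensPl linearP IHp IHq linearP tensPl linearP.
move: t; apply: tens_ind => [b b'|c p q IHp IHq]; last first.
  by rewrite tensPl linearP !tensPr linearP IHp IHq linearP tensPl linearP.
rewrite [ha_str _ _]tens_mapE [ha_mul _ _]tens_mulE.
(* The nested action on the left hides two inverses of [mu]; each application of [mu] cancels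
   one. *)
do 2!apply: (bij_inj bmu).
rewrite !pair_actE (hm_str mact) (hm_str mact') pair_actE.
(* Commutation moves the action of [b] outside that of [a'], so that [a] meets [b] and [a'] meets
   [b'] and both associativity laws apply. *)
rewrite -comm (hm_assoc mact') (hm_assoc mact).
rewrite (hm_str mact).
by rewrite !(ha_strM (ha_ax HA)).
Qed.
End PairAction.

Section Restriction.
Context (M : lmodType k) (mu : {linear M -> M}).
Context (act : {linear (A ⊗ A') ⊗ M -> M}).

(** The swap presents a ↦ a ⊗ 1 as a linear map, since [tens_pure] is registered as linear in its
    second argument. *)
Definition restrictl : {linear A ⊗ M -> M} :=
  act \o tens_map (tens_swap A' A \o tens_pure (ha_one HA')) (lid M).

Definition restrictr : {linear A' ⊗ M -> M} :=
  act \o tens_map (tens_pure (ha_one HA)) (lid M).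

Lemma restrictlE a m : restrictl (a ⊗t m) = act ((a ⊗t ha_one HA') ⊗t m).
Proof. by rewrite /restrictl /= tens_mapE /= tens_swapE. Qed.

Lemma restrictrE a' m : restrictr (a' ⊗t m) = act ((ha_one HA ⊗t a') ⊗t m).
Proof. by rewrite /restrictr /= tens_mapE. Qed.

Hypothesis mact : is_hom_module (tens_alg HA HA') act mu.

Let assocE a a' b b' m :
  act ((ha_str HA a ⊗t ha_str HA' a') ⊗t act ((b ⊗t b') ⊗t m)) =
  act ((ha_mul HA (a ⊗t b) ⊗t ha_mul HA' (a' ⊗t b')) ⊗t mu m).
Proof.
have := hm_assoc mact (a ⊗t a') (b ⊗t b') m.
by rewrite [ha_str _ _]tens_mapE [ha_mul _ _]tens_mulE.
Qed.

Let strE a a' m :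
  mu (act ((a ⊗t a') ⊗t m)) = act ((ha_str HA a ⊗t ha_str HA' a') ⊗t mu m).
Proof. by rewrite (hm_str mact) [ha_str _ _]tens_mapE. Qed.

Let HAx := ha_ax HA.
Let HAx' := ha_ax HA'.

(** Since 1 * 1 = alpha(1) = 1, the map a ↦ a ⊗ 1 respects products, units and structure maps, so
    the module axioms pull back along it. *)
Lemma restrictl_module : is_hom_module HA restrictl mu.
Proof.
split=> [|a m|a b m|m]; first exact: hm_bij mact.
- by rewrite !restrictlE strE (ha_str1 HAx').
- rewrite !restrictlE -[ha_one HA' in LHS](ha_str1 HAx') assocE.
  by rewrite (ha_str1 HAx') (ha_mul1 HAx') (ha_str1 HAx').
- by rewrite restrictlE (hm_unit mact).
Qed.

Lemma restrictr_module : is_hom_module HA' restrictr mu.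
Proof.
split=> [|a m|a b m|m]; first exact: hm_bij mact.
- by rewrite !restrictrE strE (ha_str1 HAx).
- rewrite !restrictrE -[ha_one HA in LHS](ha_str1 HAx) assocE.
  by rewrite (ha_str1 HAx) (ha_mul1 HAx) (ha_str1 HAx).
- by rewrite restrictrE (hm_unit mact).
Qed.

(** Associativity merges the two actions into that of (a * 1) ⊗ (1 * a') = alpha(a) ⊗ alpha(a') on
    [mu m]. *)
Let restrict_lr a a' m :
  restrictl (ha_str HA a ⊗t restrictr (a' ⊗t m)) =
  mu (act ((a ⊗t a') ⊗t m)).
Proof.
rewrite restrictlE restrictrE -(ha_str1 HAx') assocE strE.
by rewrite (ha_mul1 HAx) (ha_1mul HAx').
Qed.

(** Multiplication by 1 on either side is alpha, so both orders of acting give [mu] of the action of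
    a ⊗ a'. *)
Lemma restrict_commuting : commuting_actions restrictl restrictr.
Proof.
move=> a a' m; rewrite restrict_lr restrictlE restrictrE -(ha_str1 HAx) assocE.
by rewrite strE (ha_1mul HAx) (ha_mul1 HAx').
Qed.

Lemma pair_act_restrict (bmu : bijective mu) :
  pair_act bmu restrictl restrictr = act.
Proof.
apply: linear_ext; apply: tens_eq => t m; move: t.
apply: tens_ind => [a a'|c p q IHp IHq]; last by rewrite tensPl !linearP IHp IHq.
by apply: (bij_inj bmu); rewrite pair_actE restrict_lr.
Qed.
End Restriction.

Lemma restrictl_pair_act (M : lmodType k) (mu : {linear M -> M})
    (bmu : bijective mu) act act' :
  is_hom_module HA act mu -> is_hom_module HA' act' mu ->
  restrictl (pair_act bmu act act') = act.
Proof.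
move=> mact mact'; apply: linear_ext; apply: tens_eq => a m.
by rewrite restrictlE pair_actl.
Qed.

Lemma restrictr_pair_act (M : lmodType k) (mu : {linear M -> M})
    (bmu : bijective mu) act act' :
  is_hom_module HA act mu ->
  restrictr (pair_act bmu act act') = act'.
Proof.
move=> mact; apply: linear_ext; apply: tens_eq => a m.
by rewrite restrictrE (pair_actr _ _ mact).
Qed.

Section Linearity.
Context (M N : lmodType k) (muM : {linear M -> M}) (muN : {linear N -> N}).
Context (g : {linear M -> N}).
Hypothesis g_mu : forall m, g (muM m) = muN (g m).

Lemma pair_act_hom (bM : bijective muM) (bN : bijective muN)
    (actM : {linear A ⊗ M -> M}) (actM' : {linear A' ⊗ M -> M})
    (actN : {linear A ⊗ N -> N}) (actN' : {linear A' ⊗ N -> N}) :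
  (forall a m, g (actM (a ⊗t m)) = actN (a ⊗t g m)) ->
  (forall a m, g (actM' (a ⊗t m)) = actN' (a ⊗t g m)) ->
  forall t m, g (pair_act bM actM actM' (t ⊗t m)) =
              pair_act bN actN actN' (t ⊗t g m).
Proof.
move=> ga ga'; apply: tens_ind => [a a'|c p q IHp IHq] m; last first.
  by rewrite !tensPl !linearP IHp IHq.
by apply: (bij_inj bN); rewrite pair_actE -g_mu pair_actE ga ga'.
Qed.
End Linearity.
End TensorModules.

(** * Contraction against functionals on a finite-dimensional space *)

Section Contraction.
Context (k : fieldType) (B : vectType k).
Local Notation dual := 'Hom(B, k^o).

Definition contract (M : lmodType k) (f : dual) : {linear B ⊗ M -> M} :=
  tens_scalel M \o tens_map f (lid M).

Lemma contractE (M : lmodType k) f b (m : M) : contract M f (b ⊗t m) = f b *: m.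
Proof. by rewrite /contract /= tens_mapE tens_scalelE. Qed.

Lemma contractPl (M : lmodType k) a f g (t : B ⊗ M) :
  contract M (a *: f + g) t = a *: contract M f t + contract M g t.
Proof.
move: t; apply: tens_ind => [b m|c p q IHp IHq].
  by rewrite !contractE add_lfunE scale_lfunE scalerDl scalerA.
rewrite !(linearP (contract _ _)) IHp IHq !scalerDr !scalerA mulrC.
by rewrite addrACA.
Qed.

Lemma contract_map (M N : lmodType k) (u : {linear B -> B}) (g : {linear M -> N})
    f (t : B ⊗ M) :
  contract N f (tens_map u g t) = g (contract M (f \o linfun u)%VF t).
Proof.
move: t; apply: tens_ind => [b m|c p q IHp IHq].
  by rewrite tens_mapE !contractE comp_lfunE lfunE linearZ.
rewrite (linearP (tens_map _ _)) !(linearP (contract _ _)) IHp IHq.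
by rewrite linearP.
Qed.

Definition dual_basis (i : 'I_(\dim {:B})) : dual :=
  linfun (coord (vbasis {:B}) i : {linear B -> k^o}).

Lemma dual_basisE i b : dual_basis i b = coord (vbasis {:B}) i b.
Proof. by rewrite lfunE. Qed.

(** The first leg is expanded in a basis of [B]. Finite dimension thus makes the contractions
    jointly injective and suggests the formula for [dual_coact]. *)
Lemma contract_sum (M : lmodType k) (t : B ⊗ M) :
  t = \sum_(i < \dim {:B}) (vbasis {:B})`_i ⊗t contract M (dual_basis i) t.
Proof.
move: t; apply: tens_ind => [b m|c p q IHp IHq].
  rewrite [in LHS](coord_vbasis (memvf b)).
  (* The map x ↦ x ⊗ m, packaged as linear so that it passes through the basis sum. *)
  pose L : {linear B -> B ⊗ M} := tens_swap M B \o tens_pure m.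
  have LE x : L x = x ⊗t m by rewrite /L /= tens_swapE.
  rewrite -LE linear_sum; apply: eq_bigr => i _.
  by rewrite contractE dual_basisE !linearZ /= tens_swapE.
rewrite [in LHS]IHp [in LHS]IHq scaler_sumr -big_split; apply: eq_bigr => i _.
by rewrite (linearP (contract _ _)) tensPr.
Qed.

Lemma contract_inj (M : lmodType k) (s t : B ⊗ M) :
  (forall f, contract M f s = contract M f t) -> s = t.
Proof.
by move=> st; rewrite (contract_sum s) (contract_sum t); under eq_bigr do rewrite st.
Qed.

Section DualAction.
Context (M : lmodType k).

Fact dual_act_bilinear (rho : {linear M -> B ⊗ M}) :
  bilinear_for *:%R *:%R (fun (f : dual) m => contract M f (rho m)).
Proof. by split=> [m a f g|f a m n] /=; [exact: contractPl | rewrite !linearP]. Qed.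

Definition dual_act rho : {linear dual ⊗ M -> M} :=
  tens_lift (dual_act_bilinear rho).

Lemma dual_actE rho f m : dual_act rho (f ⊗t m) = contract M f (rho m).
Proof. exact: tens_liftE. Qed.

(** The only candidate for an inverse of [dual_act]: the expansion in [contract_sum], with the
    contractions of the coaction replaced by the given action. *)
Definition dual_coact_fun (act : {linear dual ⊗ M -> M}) (m : M) : B ⊗ M :=
  \sum_(i < \dim {:B}) (vbasis {:B})`_i ⊗t act (dual_basis i ⊗t m).

Fact dual_coact_is_linear act : linear (dual_coact_fun act).
Proof.
move=> a m n; rewrite /dual_coact_fun scaler_sumr -big_split.
by apply: eq_bigr => i _; rewrite tensPr linearP tensPr.
Qed.

HB.instance Definition _ act :=
  GRing.isLinear.Build k M (B ⊗ M) *:%R (dual_coact_fun act)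
    (dual_coact_is_linear act).

Definition dual_coact act : {linear M -> B ⊗ M} := dual_coact_fun act.

(** Writing e_i for the basis and e^i for its dual, f = sum_i f(e_i) e^i turns the right-hand side
    into the contraction of the sum defining [dual_coact]. *)
Lemma contract_coact act f m : contract M f (dual_coact act m) = act (f ⊗t m).
Proof.
have {2}-> : f = \sum_(i < \dim {:B}) f (vbasis {:B})`_i *: dual_basis i.
  apply/lfunP => b; rewrite {1}(coord_vbasis (memvf b)) linear_sum sum_lfunE.
  by apply: eq_bigr => i _; rewrite scale_lfunE dual_basisE linearZ; exact: mulrC.
pose L : {linear dual -> M} := act \o (tens_swap M dual \o tens_pure m).
have LE x : L x = act (x ⊗t m) by rewrite /L /= tens_swapE.
rewrite -LE !linear_sum; apply: eq_bigr => i _.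
by rewrite contractE linearZ LE.
Qed.

Lemma dual_actK : cancel dual_act dual_coact.
Proof.
move=> rho; apply: linear_ext => m; apply: contract_inj => f.
by rewrite contract_coact dual_actE.
Qed.

Lemma dual_coactK : cancel dual_coact dual_act.
Proof.
move=> act; apply: linear_ext; apply: tens_eq => f m.
by rewrite dual_actE contract_coact.
Qed.
End DualAction.

(** Contraction is natural in the second leg, which gives linearity from colinearity; the converse
    follows by joint injectivity. *)
Lemma dual_act_colinear (M N : lmodType k) (rM : {linear M -> B ⊗ M})
    (rN : {linear N -> B ⊗ N}) (g : {linear M -> N}) :
  (forall m, rN (g m) = tens_map (lid B) g (rM m)) <->
  (forall f m, g (dual_act rM (f ⊗t m)) = dual_act rN (f ⊗t g m)).
Proof.
have cmap f t : contract N f (tens_map (lid B) g t) = g (contract M f t).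
  rewrite contract_map; congr (g (contract M _ t)).
  by apply/lfunP => b; rewrite comp_lfunE lfunE.
split=> [cg f m|lg m]; first by rewrite !dual_actE cg cmap.
by apply: contract_inj => f; rewrite cmap -!dual_actE lg.
Qed.

(** * Comodules over B as modules over the opposite dual algebra *)

Section Comodules.
Context (HC : hom_coalgebra B) (M : lmodType k).
Context (rho : {linear M -> B ⊗ M}) (mu : {linear M -> M}).
Let beta := hc_str HC.
Let op := op_alg (dual_alg HC).

Lemma dual_strK f : (ha_str op f \o linfun (hc_str HC))%VF = f.
Proof.
by apply/lfunP => b; rewrite comp_lfunE [LHS]dual_strE lfunE [str_inv _ _]strK.
Qed.

(** It suffices to test equalities on functionals [ha_str op g], whose inverse of [beta] cancels the
    [beta] in the comodule axioms. *)
Let dual_str_onto f : exists g, f = ha_str op g.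
Proof. by have [g _ gK] := ha_bij (ha_ax op); exists (g f); rewrite gK. Qed.

Let contract_counit t :
  tens_scalel M (tens_map (hc_counit HC) (lid M) t) = contract M (dual_one HC) t.
Proof.
move: t; apply: tens_ind => [b m|a p q IHp IHq].
  by rewrite tens_mapE tens_scalelE contractE lfunE.
by rewrite (linearP (tens_map _ _)) (linearP (tens_scalel _)) IHp IHq linearP.
Qed.

(* Evaluating coassociativity at [ha_str op g] on the first leg in B and at
   [ha_str op f] on the second gives associativity of the action: these two
   lemmas compute its left- and right-hand sides. *)
Let contract2l f g t :
  contract M f (contract (B ⊗ M) (ha_str op g) (tens_map beta rho t)) =
  dual_act rho (f ⊗t contract M g t).
Proof. by rewrite contract_map dual_strK dual_actE. Qed.

Let contract2r f g t :
  contract M (ha_str op f) (contract (B ⊗ M) (ha_str op g)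
    (tens_assoc B B M (tens_map (hc_comul HC) mu t))) =
  contract M (ha_mul op (f ⊗t g)) (tens_map beta mu t).
Proof.
move: t; apply: tens_ind => [b m|a p q IHp IHq]; last first.
  rewrite !(linearP (tens_map _ _)) (linearP (tens_assoc _ _ _)).
  by rewrite !(linearP (contract _ _)) IHp IHq.
rewrite !tens_mapE contractE op_mulE dual_mulE (hc_strD (hc_ax HC)).
move: (hc_comul HC b); apply: tens_ind => [c d|a p q IHp IHq].
  rewrite tens_assocE contractE linearZ contractE tens_mapE tens_formE.
  by rewrite !comp_lfunE !strK -scalerA.
rewrite tensPl (linearP (tens_assoc _ _ _)) !(linearP (contract _ _)) IHp IHq.
rewrite (linearP (tens_map _ _)) (linearP (tens_form _ _)) scalerDl.
by rewrite -scalerA.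
Qed.

(** The axioms match one by one, counit with unit and coassociativity with associativity. In f . (g
    . m) the functional g meets the first leg and f the second, which up to twists evaluates the
    convolution g * f: hence the opposite product. *)
Lemma hom_comodule_dual :
  is_hom_comodule HC rho mu <-> is_hom_module op (dual_act rho) mu.
Proof.
split=> [[bij str cou coa]|[bij str ass uni]]; split=> //.
- by move=> f m; rewrite !dual_actE str contract_map dual_strK.
- move=> f g m; rewrite (dual_actE rho g) -contract2l coa contract2r.
  by rewrite dual_actE str.
- by move=> m; rewrite dual_actE -cou contract_counit.
- move=> m; apply: contract_inj => f; have [g ->] := dual_str_onto f.
  by rewrite contract_map dual_strK -!dual_actE str.
- by move=> m; rewrite contract_counit -dual_actE uni.
- move=> m; apply: contract_inj => f; apply: contract_inj => g.
  have [f' ->] := dual_str_onto f; have [g' ->] := dual_str_onto g.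
  rewrite contract2l contract2r -dual_actE ass dual_actE; congr (contract _ _ _).
  (* What remains is the compatibility of [rho] with [mu], which again follows from [str]. *)
  apply: contract_inj => h; have [h' ->] := dual_str_onto h.
  by rewrite contract_map dual_strK -!dual_actE str.
Qed.

Section Compatibility.
Context (H : lmodType k) (HH : hom_algebra H) (act : {linear H ⊗ M -> M}).

(** Contracting the Long condition at [ha_str op f] yields the commutation relation for [f], and
    such functionals exhaust the dual. *)
Lemma long_compat_dual :
  (forall h m, rho (act (h ⊗t m)) =
     tens_map beta (act_by act (ha_str HH h)) (rho m)) <->
  commuting_actions op HH (dual_act rho) act.
Proof.
have contract_act f h m : contract M (ha_str op f)
    (tens_map beta (act_by act (ha_str HH h)) (rho m)) =
    act (ha_str HH h ⊗t dual_act rho (f ⊗t m)).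
  by rewrite contract_map dual_strK dual_actE.
split=> [cpt f h m|cpt h m]; first by rewrite dual_actE cpt contract_act.
apply: contract_inj => f; have [g ->] := dual_str_onto f.
by rewrite contract_act -dual_actE cpt.
Qed.
End Compatibility.
End Comodules.

End Contraction.

(** The images under [T] have other endpoints than the original morphisms, so each morphism is
    compared together with its endpoints; [inj_pair2] drops them once the objects are identified. *)
Lemma functor_id_eq (C : category) (T : functor C C) :
  (forall X Y (f : @hom C X Y),
     existT (fun P : ob C * ob C => hom P.1 P.2) (fob T X, fob T Y) (fhom T f) =
     existT _ (X, Y) f) ->
  T = functor_id C.
Proof.
case: T => F Fh F1 FM /= Tid.
have /funext F_id X : F X = X.
  (* Every object carries its identity, so the hypothesis on morphisms already determines the object
     map. *)
  by have /(congr1 (fun u => (projT1 u).1)) := Tid X X (cid X).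
subst F.
have Fh_id : Fh = fun X Y f => f.
  apply: functional_extensionality_dep => X.
  apply: functional_extensionality_dep => Y; apply/funext => f.
  exact: inj_pair2 (Tid X Y f).
by subst Fh; congr Functor; apply: Prop_irrelevance.
Qed.

(** * The two mutually inverse functors *)

Section LongDimodulesAsModules.
Context (k : fieldType) (H : lmodType k) (B : vectType k).
Context (HH : hom_hopf H) (HB : hom_hopf B).
Let op := op_alg (dual_alg (hb_coalg HB)).
Let HA := tens_alg op (hb_alg HH).
Local Notation long := (long_dimodule HH HB).
Local Notation module := (hom_module HA).

(** A round trip keeps the carrier and [mu] by conversion, so only the operations need equations. As
    variables they can be substituted under the axiom proofs, which proof irrelevance then
    identifies. *)
Lemma long_hom_eq (M N : long) aM rM mM cM xM aN rN mN cN xN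
    (f : long_dimodule_hom
           (@LongDimodule _ _ _ HH HB (ld_space M) aM rM (ld_mu M) mM cM xM)
           (@LongDimodule _ _ _ HH HB (ld_space N) aN rN (ld_mu N) mN cN xN))
    (g : long_dimodule_hom M N) :
  aM = ld_act M -> rM = ld_coact M -> aN = ld_act N -> rN = ld_coact N ->
  ldh_fun f =1 ldh_fun g ->
  existT (fun P : long * long => long_dimodule_hom P.1 P.2) (_, _) f =
  existT _ (M, N) g.
Proof.
move=> eaM erM eaN erN; subst aM rM aN rN.
case: M N mM cM xM mN cN xN f g.
move=> SM aM rM uM mM' cM' xM' [SN aN rN uN mN' cN' xN'] /= mM cM xM mN cN xN.
rewrite (Prop_irrelevance mM mM') (Prop_irrelevance cM cM').
rewrite (Prop_irrelevance xM xM') (Prop_irrelevance mN mN').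
rewrite (Prop_irrelevance cN cN') (Prop_irrelevance xN xN').
by move=> f g fg; have -> : f = g by exact: long_dimodule_hom_eq.
Qed.

Lemma module_hom_eq (M N : module) aM mM aN mN
    (f : hom_module_hom (@HomModule _ _ HA (hm_space M) aM (hm_mu M) mM)
                        (@HomModule _ _ HA (hm_space N) aN (hm_mu N) mN))
    (g : hom_module_hom M N) :
  aM = hm_act M -> aN = hm_act N -> hmh_fun f =1 hmh_fun g ->
  existT (fun P : module * module => hom_module_hom P.1 P.2) (_, _) f =
  existT _ (M, N) g.
Proof.
move=> eaM eaN; subst aM aN.
case: M N mM mN f g => [SM aM uM mM'] [SN aN uN mN'] /= mM mN.
rewrite (Prop_irrelevance mM mM') (Prop_irrelevance mN mN').
by move=> f g fg; have -> : f = g by exact: hom_module_hom_eq.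
Qed.

Lemma dual_act_module (M : long) :
  is_hom_module op (dual_act (ld_coact M)) (ld_mu M).
Proof. exact/hom_comodule_dual/ld_is_comodule. Qed.

Definition long_to_module_act (M : long) :=
  pair_act op (hm_bij (ld_is_module M))
    (dual_act (ld_coact M)) (ld_act M).

Fact long_to_module_ax (M : long) :
  is_hom_module HA (long_to_module_act M) (ld_mu M).
Proof.
apply: pair_act_module; [exact: dual_act_module | exact: ld_is_module |].
exact/long_compat_dual/ld_compat.
Qed.

Definition long_to_module (M : long) : module := HomModule (long_to_module_ax M).

Definition long_to_module_hom (M N : long) (f : long_dimodule_hom M N) :
  hom_module_hom (long_to_module M) (long_to_module N).
Proof.
apply: (@HomModuleHom _ _ _ (long_to_module M) (long_to_module N) (ldh_fun f)).
  apply: pair_act_hom; [exact: ldh_mu | | exact: ldh_act].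
  exact/dual_act_colinear/ldh_coact.
exact: ldh_mu.
Defined.

Definition long_functor : functor (long_dimodule_cat HH HB) (hom_module_cat HA).
Proof.
refine (@Functor (long_dimodule_cat HH HB) (hom_module_cat HA) long_to_module
  long_to_module_hom _ _) => *; exact: hom_module_hom_eq.
Defined.

Definition module_coact (N : module) : {linear hm_space N -> B ⊗ hm_space N} :=
  dual_coact (restrictl (hb_alg HH) (hm_act N)).

Definition module_act (N : module) : {linear H ⊗ hm_space N -> hm_space N} :=
  restrictr op (hm_act N).

Fact dual_act_coact_module (N : module) :
  dual_act (module_coact N) = restrictl (hb_alg HH) (hm_act N).
Proof. exact: dual_coactK. Qed.

(** Transparent, because the round trips rely on its carrier and [mu] reducing to those of [N]. *)
Definition module_to_long (N : module) : long.
Proof.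
apply: (@LongDimodule _ _ _ HH HB _ (module_act N) (module_coact N) (hm_mu N)).
- exact/restrictr_module/hm_ax.
- apply/hom_comodule_dual; rewrite dual_act_coact_module.
  exact/restrictl_module/hm_ax.
- apply/(long_compat_dual (hb_coalg HB) _ (hb_alg HH)).
  rewrite dual_act_coact_module.
  exact/restrict_commuting/hm_ax.
Defined.

Definition module_to_long_hom (M N : module) (f : hom_module_hom M N) :
  long_dimodule_hom (module_to_long M) (module_to_long N).
Proof.
apply: (@LongDimoduleHom _ _ _ HH HB (module_to_long M) (module_to_long N)
  (hmh_fun f)).
- move=> h m; change (hmh_fun f (module_act M (h ⊗t m)) =
                      module_act N (h ⊗t hmh_fun f m)).
  by rewrite !restrictrE hmh_act.
- apply/dual_act_colinear => h m.
  by rewrite !dual_act_coact_module !restrictlE hmh_act.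
- exact: hmh_mu.
Defined.

Definition module_functor : functor (hom_module_cat HA) (long_dimodule_cat HH HB).
Proof.
refine (@Functor (hom_module_cat HA) (long_dimodule_cat HH HB) module_to_long
  module_to_long_hom _ _) => *; exact: long_dimodule_hom_eq.
Defined.

Lemma long_functorK : functor_comp module_functor long_functor = functor_id _.
Proof.
apply: functor_id_eq => M N f.
have actK (L : long) : module_act (long_to_module L) = ld_act L.
  by apply: restrictr_pair_act; exact: dual_act_module.
have coactK (L : long) : module_coact (long_to_module L) = ld_coact L.
  rewrite /module_coact restrictl_pair_act ?dual_actK //.
    exact: dual_act_module.
  exact: ld_is_module.
by apply: long_hom_eq; rewrite ?actK ?coactK.
Qed.

Lemma module_functorK : functor_comp long_functor module_functor = functor_id _.
Proof.
apply: functor_id_eq => M N f.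
have actK (L : module) : long_to_module_act (module_to_long L) = hm_act L.
  rewrite /long_to_module_act /= dual_act_coact_module.
  exact/pair_act_restrict/hm_ax.
by apply: module_hom_eq; rewrite ?actK.
Qed.

End LongDimodulesAsModules.

Theorem theorem2p7 (k : fieldType) (H : lmodType k) (B : vectType k)
    (HH : hom_hopf H) (HB : hom_hopf B) :
  cat_isomorphic (long_dimodule_cat HH HB)
    (hom_module_cat (tens_alg (op_alg (dual_alg (hb_coalg HB))) (hb_alg HH))).
Proof.
exists (long_functor HH HB), (module_functor HH HB).
by split; [exact: long_functorK | exact: module_functorK].
Qed.
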